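(* Let $D=(V,A)$ be a finite loopless digraph, $f:A\to\mathbb{Z}\cup\{-\infty\}$, $g:A\to\mathbb{Z}\cup\{+\infty\}$ with $f\le g$, and $B\subseteq\mathbb{R}^V$ an integral base-polyhedron such that $Q=Q(f,g;B)$ is a non-empty integral base-flow polyhedron. Let $L\subseteq A$ be a subset of edges on which both $f$ and $g$ are finite-valued. Then there exist a face $B_L$ of $B$ and bounds $f_L:A\to\mathbb{Z}\cup\{-\infty\}$, $g_L:A\to\mathbb{Z}\cup\{+\infty\}$ with $f\le f_L\le g_L\le g$ such that an element $z\in Q\cap\mathbb{Z}^A$ is an $L$-upper-minimizer if and only if $z\in Q_L\cap\mathbb{Z}^A$, where $Q_L=Q(f_L,g_L;B_L)$.
   Context: For $x\in\mathbb{R}^V$, $\widetilde x(Z)=\sum_{v\in Z}x(v)$. A set function $p:2^V\to\mathbb{Z}\cup\{-\infty\}$ with $p(\emptyset)=0$ is supermodular if $p(X)+p(Y)\le p(X\cap Y)+p(X\cup Y)$ for all $X,Y$. For such $p$ with $p(V)$ finite, $B'(p)=\{x\in\mathbb{R}^V:\widetilde x(V)=p(V),\ \widetilde x(Z)\ge p(Z)\ \forall Z\subset V\}$ is a base-polyhedron (integral if $p$ is integer-valued where finite). For $x:A\to\mathbb{R}$, $\psi_x(v)=\sum_{uv\in A}x(uv)-\sum_{vu\in A}x(vu)$, and $Q(f,g;B)=\{x\in\mathbb{R}^A: f\le x\le g,\ \psi_x\in B\}$. An element $z\in Q\cap\mathbb{Z}^A$ is an $L$-upper-minimizer if the number of edges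 $e\in L$ with $z(e)=g(e)$ (the $g$-saturated edges of $L$) is as small as possible among all elements of $Q\cap\mathbb{Z}^A$. *)

(* Defs.v *)
From HB Require Import structures.
From mathcomp Require Import all_boot all_order all_algebra.
From mathcomp Require Import all_classical all_reals.
Set Implicit Arguments.
Unset Strict Implicit.
Unset Printing Implicit Defensive.
Import Order.TTheory GRing.Theory Num.Theory.
Local Open Scope classical_set_scope.
Local Open Scope ring_scope.

Definition intvec (R : realType) (I : finType) (z : I -> int) : I -> R :=
  fun i => (z i)%:~R.

Definition exint (R : realType) (a : \bar int) : \bar R := er_map intr a.

(* The value +oo of \bar int is excluded: p takes values in Z and -oo. *)
Definition supermodular (V : finType) (p : {set V} -> \bar int) : Prop :=
  [/\ forall X, p X != +oo%E,
      p finset.set0 = 0%E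
    & forall X Y : {set V}, (p X + p Y <= p (X :&: Y)%SET + p (X :|: Y)%SET)%E].

Definition wt (R : realType) (V : finType) (x : V -> R) (Z : {set V}) : R :=
  \sum_(v in Z) x v.

Definition base_poly (R : realType) (V : finType) (p : {set V} -> \bar int) :
    set (V -> R) :=
  [set x | (wt x [set: V]%SET)%:E = exint R (p [set: V]%SET) /\
           forall Z : {set V}, (exint R (p Z) <= (wt x Z)%:E)%E].

Definition integral_base_polyhedron (R : realType) (V : finType)
    (B : set (V -> R)) : Prop :=
  exists p : {set V} -> \bar int,
    [/\ supermodular p, p [set: V]%SET \is a fin_num & B = base_poly p].

(* Faces in the sense of polyhedral theory: non-empty intersections with a
   supporting hyperplane; c = 0 is allowed, so P is a face of itself. *)
Definition face (R : realType) (V : finType) (P F : set (V -> R)) : Prop :=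
  F !=set0 /\
  exists (c : V -> R) (d : R),
    (forall x, P x -> d <= \sum_v c v * x v) /\
    F = [set x | P x /\ \sum_v c v * x v = d].

(* An arc e goes from tail e to head e, so excess is inflow minus outflow. *)
Definition excess (R : realType) (V A : finType) (tail head : A -> V)
    (x : A -> R) : V -> R :=
  fun v => \sum_(e | head e == v) x e - \sum_(e | tail e == v) x e.

Definition base_flow (R : realType) (V A : finType) (tail head : A -> V)
    (f g : A -> \bar int) (B : set (V -> R)) : set (A -> R) :=
  [set x | (forall e, (exint R (f e) <= (x e)%:E <= exint R (g e))%E) /\
           B (excess tail head x)].

Definition saturated (A : finType) (g : A -> \bar int) (L : {set A})
    (z : A -> int) : {set A} :=
  [set e in L | (z e)%:E == g e]%SET.

Definition upper_minimizer (R : realType) (A : finType) (Q : set (A -> R))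
    (g : A -> \bar int) (L : {set A}) (z : A -> int) : Prop :=
  Q (intvec R z) /\
  forall y : A -> int, Q (intvec R y) ->
    (#|saturated g L z| <= #|saturated g L y|)%N.

(* Main.v *)
(* On t <= g e the indicator of saturation is the restriction of the convex
   function max(0, t - g e + 1), so L-upper-minimizers minimize a separable
   convex cost C over integral submodular flows.  At an integral optimum z the
   auxiliary digraph (residual edges, joined through the exchanges of the base
   polyhedron at psi_z) has no negative cycle: along a shortest one the
   exchanges can be ordered so that they can be performed one after the other,
   which gives a cheaper flow.  Shortest distances are then a potential pi with
   cost(y) = sum_e (C e (y e) - D e * y e) + <pi, psi_y>,
   D e = pi(head e) - pi(tail e), every term of which is minimal at z.  Hence y
   is optimal iff each y e lies in the integer interval of minimizers of
   C e t - D e * t, which gives f_L and g_L, and psi_y lies in the face of B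
   minimizing pi. *)
Require Import Defs.
From HB Require Import structures.
From mathcomp Require Import all_boot all_order all_algebra.
From mathcomp Require Import all_classical all_reals.
From mathcomp Require Import zify ring.
Set Implicit Arguments.
Unset Strict Implicit.
Unset Printing Implicit Defensive.
Import Order.TTheory GRing.Theory Num.Theory.
Local Open Scope classical_set_scope.
Local Open Scope ring_scope.

(** * Cyclic sequences and their successor lists *)

Lemma nth_rot1 (T : Type) (x0 : T) (s : seq T) i : (i < size s)%N ->
  nth x0 (rot 1 s) i = if (i.+1 < size s)%N then nth x0 s i.+1 else nth x0 s 0.
Proof.
case: s => [//|x s]; rewrite rot1_cons nth_rcons /= !ltnS.
by case: ltngtP => // -> _.
Qed.

Lemma cycleE (T : Type) (r : rel T) (x0 : T) (s : seq T) : (0 < size s)%N ->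
  cycle r s = sorted r s && r (last x0 s) (head x0 s).
Proof. by case: s => [//|x s] _ /=; rewrite rcons_path. Qed.

Lemma cycle_sorted (T : Type) (r : rel T) (s : seq T) : cycle r s -> sorted r s.
Proof. by case: s => [//|x s] /=; rewrite rcons_path => /andP[]. Qed.

(** * Negative cycles and distances in node-weighted digraphs *)

Section WeightedDigraph.
Variables (N : finType) (r : rel N) (c : N -> int).

Let cost (s : seq N) : int := \sum_(a <- s) c a.

Lemma cycle_nth_rot (a : N) (s : seq N) i : cycle r s -> (i < size s)%N ->
  r (nth a s i) (nth a (rot 1 s) i).
Proof.
case: s => [//|b s]; rewrite rot1_cons => /(pathP a) /(_ i) + lti.
rewrite size_rcons => /(_ lti).
by rewrite -rcons_cons nth_rcons lti.
Qed.

(** [rot 1 s] lists cyclic successors, so a chord from i to the successor of an earlier j closes up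
    the segment from j+1 to i. *)
Lemma cycle_drop_take (a : N) (s : seq N) i j : cycle r s -> (j < i < size s)%N ->
  r (nth a s i) (nth a (rot 1 s) j) -> cycle r (drop j.+1 (take i.+1 s)).
Proof.
move=> cs /andP[ji si] rij.
have sz : size (drop j.+1 (take i.+1 s)) = (i - j)%N.
  by rewrite size_drop size_takel // subSS.
rewrite (cycleE _ a); last by rewrite sz subn_gt0.
rewrite drop_sorted ?take_sorted ?cycle_sorted // andTb.
rewrite -nth_last -nth0 sz !nth_drop !nth_take; try lia.
have -> : (j.+1 + (i - j).-1)%N = i by lia.
by move: rij; rewrite nth_rot1; [rewrite addn0 ifT //; lia | lia].
Qed.

(** A chord to the successor of a later j bypasses positions i+1 to j; if j is last, that successor
    is the head of s and only the prefix remains. *)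
Lemma cycle_take_drop (a : N) (s : seq N) i j : cycle r s -> (i < j < size s)%N ->
  r (nth a s i) (nth a (rot 1 s) j) -> cycle r (take i.+1 s ++ drop j.+1 s).
Proof.
move=> cs /andP[ij sj]; rewrite nth_rot1 // => rij.
have si : (i.+1 <= size s)%N by lia.
have ss := cycle_sorted cs.
rewrite (cycleE _ a); last by rewrite size_cat size_takel.
case: ltnP rij => [ltj|lej] rij; last first.
  rewrite (drop_oversize lej) cats0 take_sorted // andTb.
  by rewrite -nth_last -nth0 size_takel // !nth_take.
have sd : drop j.+1 s = nth a s j.+1 :: drop j.+2 s by rewrite -drop_nth.
have hd : head a (take i.+1 s ++ drop j.+1 s) = head a s.
  by case: (s) si.
rewrite hd last_cat; apply/andP; split.
  have : sorted r (take i.+1 s) by rewrite take_sorted.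
  have : sorted r (drop j.+1 s) by rewrite drop_sorted.
  have : nth a s i = last a (take i.+1 s) by rewrite -nth_last size_takel // nth_take.
  case: (take i.+1 s) (size_takel si) => [//|b t] _ /= E sd1 pt.
  by rewrite cat_path pt /= sd /= -E rij /=; move: sd1; rewrite sd.
have -> : last (last a (take i.+1 s)) (drop j.+1 s) = last a s.
  by rewrite -last_cat -[in RHS](cat_take_drop j.+1 s) !last_cat sd.
by move: cs; rewrite (cycleE _ a) ?(leq_trans _ si) // => /andP[].
Qed.

(* A chord closes a strictly shorter cycle, of nonnegative cost by minimality;
   this is what forces the chord to decrease (prefix cost, index)
   lexicographically. *)
Lemma shortest_negative_cycle (s0 : seq N) : cycle r s0 -> \sum_(a <- s0) c a < 0 ->
  exists (s : seq N) (l : seq (N * N)),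
    [/\ uniq s /\ \sum_(a <- s) c a < 0, cycle r s,
        perm_eq (unzip1 l) s /\ perm_eq (unzip2 l) s,
        all (fun p => r p.1 p.2) l & pairwise (fun p q => ~~ r p.1 q.2) l].
Proof.
move=> cs0 neg0.
pose P n := `[< exists s, [/\ size s = n, cycle r s & cost s < 0] >].
have exP : exists n, P n by exists (size s0); apply/asboolP; exists s0.
case: (ex_minnP exP) => k /asboolP[s [sk cs neg]] min_k.
have {}min_k t : cycle r t -> (size t < k)%N -> 0 <= cost t.
  move=> ct; rewrite ltnNge leNgt; apply: contra => negt.
  by apply: min_k; apply/asboolP; exists t.
have [a _] : exists a : N, True.
  by case: s neg {sk cs} => [|a s _]; [rewrite /cost big_nil | exists a].
pose S i := cost (take i.+1 s).
have cost_cat u v : cost (u ++ v) = cost u + cost v by rewrite /cost big_cat.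
have chord i j : (i < k)%N -> (j < k)%N -> i != j ->
    r (nth a s i) (nth a (rot 1 s) j) -> S j < S i \/ S j = S i /\ (j < i)%N.
  (* For i < j the shortcut has nonnegative cost while s is negative, so the bypassed part, of cost
     S j - S i, is negative. For j < i the segment closed up costs S i - S j >= 0. *)
  move=> ik jk; rewrite neq_ltn => /orP[] ij rij.
    left; have := min_k _ (cycle_take_drop cs _ rij).
    rewrite ij sk jk => /(_ isT); rewrite size_cat size_takel ?size_drop ?sk //.
    rewrite cost_cat => h; have {}h := h ltac:(lia).
    have := neg.
    by rewrite -(cat_take_drop j.+1 s) cost_cat /S; lia.
  have := min_k _ (cycle_drop_take cs _ rij).
  rewrite ij sk ik => /(_ isT); rewrite size_drop size_takel ?sk //.
  have : S i = S j + cost (drop j.+1 (take i.+1 s)).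
    rewrite /S -cost_cat -{1}(cat_take_drop j.+1 (take i.+1 s)) take_takel //.
    by lia.
  by move=> -> h; have {}h := h ltac:(lia); lia.
have [s'k S's] : size (rot 1 s) = k /\ perm_eq (rot 1 s) s.
  by rewrite size_rot perm_rot.
(* In this order a chord from a position to the successor of a later one cannot exist. *)
pose leS : rel nat := fun i j => (S i < S j) || (S i == S j) && (i <= j)%N.
have leS_tr : transitive leS by move=> y x z; rewrite /leS; lia.
have leS_tot : total leS by move=> x y; rewrite /leS; lia.
pose t := sort leS (iota 0 k).
have t_iota : perm_eq t (iota 0 k) by rewrite perm_sort.
have mem_t i : (i \in t) = (i < k)%N by rewrite (perm_mem t_iota) mem_iota.
have map_nth u : size u = k -> perm_eq (map (nth a u) t) u.
  move=> su; rewrite -[X in perm_eq _ X](mkseq_nth a) su.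
  exact: perm_map.
exists s, [seq (nth a s i, nth a (rot 1 s) i) | i <- t]; split=> //.
(* Equal nodes at i and j would give chords both ways, each strictly decreasing (S, index). *)
- split=> //; apply/(uniqP a) => i j; rewrite !inE !sk => ik jk eij.
  apply/eqP/negPn/negP => nij.
  have ri := cycle_nth_rot a cs; rewrite sk in ri.
  have /(chord _ _ ik jk nij) : r (nth a s i) (nth a (rot 1 s) j) by rewrite eij ri.
  rewrite eq_sym in nij.
  have /(chord _ _ jk ik nij) : r (nth a s j) (nth a (rot 1 s) i) by rewrite -eij ri.
  lia.
- rewrite /unzip1 /unzip2 -!map_comp; split.
    exact: map_nth.
  exact: perm_trans (map_nth _ s'k) S's.
- rewrite all_map; apply/allP => i; rewrite mem_t => ik /=.
  by rewrite cycle_nth_rot // sk.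
rewrite pairwise_map.
have : pairwise [rel i j | leS i j && (i != j)] t.
  rewrite pairwise_relI -(sorted_pairwise leS_tr) sort_sorted //.
  by rewrite -uniq_pairwise (perm_uniq t_iota) iota_uniq.
apply: (@sub_in_pairwise _ (fun i => i < k)%N); last by apply/allP => i; rewrite mem_t.
move=> i j ik jk /= /andP[lij nij]; apply/negP => /(chord _ _ ik jk nij).
by move: lij; rewrite /leS; lia.
Qed.

Hypothesis nneg : forall s, cycle r s -> 0 <= \sum_(a <- s) c a.

(** If the first node recurs, the closed walk cut off is a cycle, of nonnegative cost by [nneg]. *)
Lemma uniq_path_cost a s : path r a s ->
  exists s', [/\ path r a s', last a s' = last a s, uniq (a :: s')
                & cost (a :: s') <= cost (a :: s)].
Proof.
elim: s a => [|b s IH] a /=; first by exists [::].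
move=> /andP[rab /IH [s' [ps' ls' us' les']]].
have leab : cost [:: a, b & s'] <= cost [:: a, b & s].
  by rewrite /cost big_cons [leRHS]big_cons lerD2l.
have : path r a (b :: s') by rewrite /= rab.
have [ain|nas] := boolP (a \in b :: s'); last first.
  by exists (b :: s'); split=> //; rewrite cons_uniq nas.
have {ls'} : last a (b :: s') = last b s by [].
move: (b :: s') ain us' leab => u au; case/splitPr: u / au => p q.
rewrite cat_uniq last_cat cat_path => /and3P[_ _ uq] leab /= lq /and3P[pp ra pq].
exists q; split=> //; apply: (le_trans _ leab).
have := @nneg (a :: p); rewrite /= rcons_path pp => /(_ ra) cp.
by rewrite -cat_cons /cost big_cat /= lerDr.
Qed.

Lemma path_cost_ge a s : path r a s -> - \sum_(b : N) `|c b| <= \sum_(b <- a :: s) c b.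
Proof.
move=> /uniq_path_cost[s' [_ _ us']]; apply: le_trans.
rewrite /cost; move: (a :: s') us' => u uu.
rewrite [leRHS]big_uniq //.
apply: (@le_trans _ _ (- \sum_(b in u) `|c b|)).
  by rewrite lerN2 [leRHS](bigID (mem u)) /= lerDl sumr_ge0.
by rewrite -sumrN ler_sum // => b _; rewrite lerNnormlW.
Qed.

(** d a is the least cost of a walk ending in a, from any start: one-node walks give the first
    bound, appending b gives the second. *)
Lemma digraph_distance : exists d : N -> int,
  (forall a, d a <= c a) /\ (forall a b, r a b -> d b <= d a + c b).
Proof.
(* Adding K makes all walk costs nonnegative, so the minimum can be taken over naturals. *)
pose K : int := \sum_(b : N) `|c b|.
pose P a n := `[< exists b s, [/\ path r b s, last b s = a & cost (b :: s) + K = n%:Z] >].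
have walkP b s : path r b s -> exists n, P (last b s) n /\ cost (b :: s) + K = n%:Z.
  move=> pbs; exists (absz (cost (b :: s) + K)).
  have e : cost (b :: s) + K = (absz (cost (b :: s) + K))%:Z.
    by rewrite gez0_abs // -lerBlDr sub0r path_cost_ge.
  by split=> //; apply/asboolP; exists b, s.
have exP a : exists n, P a n by have [n [] ] := walkP a [::] isT; exists n.
pose d a := (ex_minn (exP a))%:Z - K.
exists d; split=> [a | a b rab]; rewrite /d.
  case: ex_minnP => n _ min_n.
  have [m [/min_n nm]] := walkP a [::] isT.
  by rewrite /cost big_seq1; lia.
case: ex_minnP => n _ min_n; case: ex_minnP => m /asboolP[x [s [pxs lx em]]] _.
have [|k []] := walkP x (rcons s b); first by rewrite rcons_path pxs lx.
rewrite last_rcons => /min_n nk.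
by rewrite -rcons_cons /cost big_rcons /= -/(cost _); lia.
Qed.

End WeightedDigraph.

(** * Tight sets and exchanges in an integral base polyhedron *)

Section BasePolyhedron.
Variables (V : finType) (p : {set V} -> \bar int).
Implicit Types (x y : V -> int) (X Y Z : {set V}).

Definition wtz x Z : int := \sum_(v in Z) x v.

Definition in_base x : Prop :=
  (wtz x [set: V]%SET)%:E = p [set: V]%SET /\ forall Z, (p Z <= (wtz x Z)%:E)%E.

Definition tight x Z : bool := p Z == (wtz x Z)%:E.

(* For integral x in the base polyhedron, [exchangeable x s t] says that
   x + chi_s - chi_t stays in it. *)
Definition exchangeable x s t : bool :=
  [forall Z : {set V}, tight x Z ==> (t \in Z) ==> (s \in Z)].

Definition exchange x s t : V -> int :=
  fun v => x v + ((s == v)%:R - (t == v)%:R).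

Lemma exchangeableP x s t :
  reflect (forall Z, tight x Z -> t \in Z -> s \in Z) (exchangeable x s t).
Proof.
apply: (iffP forallP) => h Z; first by move=> tZ; apply/implyP; apply: (implyP (h Z)).
by apply/implyP => tZ; apply/implyP; apply: h.
Qed.

Lemma nexchangeableP x s t :
  reflect (exists Z, [/\ tight x Z, t \in Z & s \notin Z]) (~~ exchangeable x s t).
Proof.
rewrite negb_forall; apply: (iffP existsP) => -[Z].
  by rewrite !negb_imply => /and3P[]; exists Z.
by move=> [tZ tin sin]; exists Z; rewrite tZ tin.
Qed.

Lemma exchangeable_refl x s : exchangeable x s s.
Proof. exact/exchangeableP. Qed.

Lemma exchangeable_trans x s t u :
  exchangeable x s t -> exchangeable x t u -> exchangeable x s u.
Proof.
move=> /exchangeableP st /exchangeableP tu; apply/exchangeableP => Z tZ uZ.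
by apply: st => //; apply: tu.
Qed.

Lemma wtz_exchange x s t Z :
  wtz (exchange x s t) Z = wtz x Z + ((s \in Z)%:R - (t \in Z)%:R).
Proof.
have sum_ind a : \sum_(v in Z) (a == v)%:R = (a \in Z)%:R :> int.
  have [aZ|naZ] := boolP (a \in Z).
    rewrite (bigD1 a) //= eqxx big1 ?addr0 // => v /andP[_].
    by rewrite eq_sym => /negPf ->.
  rewrite big1 // => v vZ; case: eqP => // av.
  by rewrite av vZ in naZ.
by rewrite /wtz big_split sumrB !sum_ind.
Qed.

Lemma wtzIU x X Y : wtz x (X :&: Y)%SET + wtz x (X :|: Y)%SET = wtz x X + wtz x Y.
Proof.
have E Z : wtz x Z = \sum_v x v * (v \in Z)%:R.
  by rewrite /wtz big_mkcond; apply: eq_bigr => v _; case: ifP; rewrite ?mulr1 ?mulr0.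
rewrite !E -!big_split; apply: eq_bigr => v _ /=; rewrite !inE.
by case: (v \in X); case: (v \in Y); rewrite /= ?mulr0 ?mulr1; lia.
Qed.

Hypothesis p_super : supermodular p.

(** Uncrossing: x is modular and dominates p, so supermodularity forces equality on the intersection
    and the union. *)
Lemma tightIU x X Y : in_base x -> tight x X -> tight x Y ->
  tight x (X :&: Y)%SET && tight x (X :|: Y)%SET.
Proof.
move=> [_ px] /eqP tX /eqP tY; have [pfin _ /(_ X Y)] := p_super.
have := wtzIU x X Y; rewrite /tight tX tY.
move: (px (X :&: Y)%SET) (px (X :|: Y)%SET) (pfin (X :&: Y)%SET) (pfin (X :|: Y)%SET).
case: (p (X :&: Y)%SET) => [a||] //; case: (p (X :|: Y)%SET) => [b||] //.
rewrite -!EFinD !lee_fin => ha hb _ _ e h.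
by apply/andP; split; apply/eqP; congr EFin; lia.
Qed.

Lemma tight0 x : tight x finset.set0.
Proof. by have [_ p0 _] := p_super; rewrite /tight p0 /wtz big_set0. Qed.

Lemma tightT x : in_base x -> tight x [set: V]%SET.
Proof. by case=> + _; rewrite /tight => ->. Qed.

(** Only sets containing t but not s lose weight, by one unit; they are not tight, hence have
    integral slack at least 1. *)
Lemma exchange_in_base x s t : in_base x -> exchangeable x s t -> in_base (exchange x s t).
Proof.
move=> [xV px] /exchangeableP st; split=> [|Z].
  by rewrite wtz_exchange !inE subrr addr0.
rewrite wtz_exchange; move: (px Z) (st Z); rewrite /tight.
case: (p Z) => [a||]; rewrite ?leNye // !lee_fin eqe => ha h.
have [e|ne] := eqVneq a (wtz x Z).
  move: h; rewrite e eqxx => /(_ isT).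
  by case: (t \in Z) => [/(_ isT) ->|_]; case: (s \in Z); lia.
by case: (t \in Z) (s \in Z) => -[]; lia.
Qed.

Lemma tight_exchange x s t Z : s \notin Z -> t \notin Z ->
  tight (exchange x s t) Z = tight x Z.
Proof. by move=> /negPf sZ /negPf tZ; rewrite /tight wtz_exchange sZ tZ subrr addr0. Qed.

(* Performing the first exchange leaves the tight sets that separate the
   remaining pairs from it unaffected. *)
Lemma exchange_seq_in_base (l : seq (V * V)) x : in_base x ->
  all (fun q => exchangeable x q.1 q.2) l ->
  pairwise (fun q q' => ~~ exchangeable x q.1 q'.2) l ->
  in_base (fun v => x v + \sum_(q <- l) ((q.1 == v)%:R - (q.2 == v)%:R)).
Proof.
elim: l x => [|[s t] l IH] x xB.
  by move=> _ _; under eq_fun do rewrite big_nil addr0.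
rewrite /= => /andP[st al] /andP[/allP sl pl].
(* A tight set omitting s also omits t, since the pair (s, t) is exchangeable; so T stays tight
   after the exchange. *)
have sep q : q \in l ->
    exists T, [/\ tight x T, tight (exchange x s t) T, q.2 \in T, s \notin T & t \notin T].
  move=> /sl /= /nexchangeableP[T [tT qT sT]]; exists T.
  have tT' : t \notin T by apply: contra sT => ?; exact: (exchangeableP _ _ _ st).
  by rewrite tight_exchange.
have xB' := exchange_in_base xB st.
under eq_fun do rewrite big_cons addrA.
apply: (IH (exchange x s t) xB').
  (* The intersection of Z and T avoids s and t, so it was tight before the exchange and contains
     q.1. *)
  apply/allP => q ql; apply/exchangeableP => Z tZ qZ.
  have [T [_ tT' qT sT tT]] := sep _ ql.
  have /andP[tI _] := tightIU xB' tZ tT'.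
  rewrite tight_exchange ?inE ?(negPf sT) ?(negPf tT) ?andbF // in tI.
  have := exchangeableP _ _ _ (allP al _ ql) _ tI.
  by rewrite !inE qZ qT => /(_ isT)/andP[].
apply: (@sub_in_pairwise _ (mem l)) pl; last exact/allP.
(* Intersecting the separating set Z with T lets it stay tight after the exchange. *)
move=> q q' _ q'l /= /nexchangeableP[Z [tZ q'Z qZ]].
have [T [tT _ q'T sT ntT]] := sep _ q'l.
have /andP[tI _] := tightIU xB tZ tT.
apply/nexchangeableP; exists (Z :&: T)%SET.
rewrite tight_exchange ?inE ?(negPf sT) ?(negPf ntT) ?andbF //.
by rewrite q'Z q'T (negPf qZ).
Qed.

(** The smallest tight set D u around u consists of the v exchangeable with u, so pi >= pi u on it.
    A superlevel set is thus a union of such sets. *)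
Lemma potential_superlevel_tight x (pi : V -> int) : in_base x ->
  (forall s t, exchangeable x s t -> pi t <= pi s) ->
  forall k, tight x [set v | k <= pi v]%SET.
Proof.
move=> xB pi_ex k.
pose D u := (\bigcap_(Z : {set V} | tight x Z && (u \in Z)) Z)%SET.
have tD u : tight x (D u).
  rewrite /D; elim/big_ind: _ => [|X Y tX tY|Z /andP[]//]; first exact: tightT.
  by have /andP[] := tightIU xB tX tY.
have -> : [set v | k <= pi v]%SET = (\bigcup_(u | k <= pi u) D u)%SET.
  apply/finset.setP => v; rewrite inE; apply/idP/finset.bigcupP => [kv|[u ku vD]].
    by exists v => //; apply/finset.bigcapP => Z /andP[].
  apply: le_trans ku _; apply: pi_ex; apply/exchangeableP => Z tZ uZ.
  by move/finset.bigcapP: vD; apply; rewrite tZ.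
elim/big_ind: _ => [|X Y tX tY|//]; first exact: tight0.
by have /andP[] := tightIU xB tX tY.
Qed.

End BasePolyhedron.

(** Shifted by M, the potential counts the levels below it, which turns the sum into superlevel
    sums; the shift is free because w sums to 0. *)
Lemma sum_superlevel_ge0 (R : numDomainType) (V : finType) (pi : V -> int) (w : V -> R) :
  \sum_v w v = 0 -> (forall k : int, 0 <= \sum_(v | k <= pi v) w v) ->
  0 <= \sum_v (pi v)%:~R * w v.
Proof.
move=> w0 wk; pose M : int := \sum_v `|pi v|.
have piM v : `|pi v| <= M by rewrite /M (bigD1 v) //= lerDl sumr_ge0.
pose n v := absz (pi v + M).
have nE v : (n v)%:Z = pi v + M by rewrite /n; have := piM v; lia.
have [K nK] : exists K, forall v, (n v <= K)%N.
  by exists (absz (M + M)) => v; have := nE v; have := piM v; lia.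
have count v : (\sum_(0 <= k < K) (k < n v)%:R) = (n v)%:R :> R.
  rewrite (big_cat_nat (n := n v)) //= big_nat (eq_bigr (fun=> 1)); last first.
    by move=> k /andP[_ ->].
  rewrite -big_nat sumr_const_nat subn0 [X in _ + X]big_nat big1 ?addr0 // => k /andP[].
  by rewrite leqNgt => /negPf ->.
have -> : \sum_v (pi v)%:~R * w v = \sum_v (n v)%:R * w v.
  have E v : (pi v)%:~R = (n v)%:R - M%:~R :> R.
    by rewrite -[(n v)%:R]/((n v)%:Z%:~R) nE intrD addrK.
  under eq_bigr do rewrite E mulrBl.
  by rewrite sumrB -mulr_sumr w0 mulr0 subr0.
under eq_bigr do rewrite -count mulr_suml.
rewrite exchange_big sumr_ge0 // => k _ /=.
have := wk (k.+1%:Z - M); rewrite big_mkcond /=.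
rewrite (eq_bigr (fun v => (k < n v)%:R * w v)) // => v _.
have -> : (k.+1%:Z - M <= pi v) = (k < n v)%N by have := nE v; lia.
by case: ifP; rewrite ?mul1r ?mul0r.
Qed.

(** * Auxiliary digraph and potentials for convex-cost submodular flows *)

Section SubmodularFlow.
Variables (V A : finType) (tail head : A -> V) (f g : A -> \bar int).
Variable p : {set V} -> \bar int.
Implicit Types y z : A -> int.

Definition excessz z (v : V) : int :=
  \sum_(e | head e == v) z e - \sum_(e | tail e == v) z e.

Definition feasible z : Prop :=
  (forall e, (f e <= (z e)%:E <= g e)%E) /\ in_base p (excessz z).

Lemma excesszE z v :
  excessz z v = \sum_e z e * ((head e == v)%:R - (tail e == v)%:R).
Proof.
rewrite /excessz big_mkcond [X in _ - X]big_mkcond -sumrB; apply: eq_bigr => e _.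
by case: eqP; case: eqP => _ _ /=; lia.
Qed.

Lemma sum_potential_excess (pi : V -> int) z :
  \sum_v pi v * excessz z v = \sum_e (pi (head e) - pi (tail e)) * z e.
Proof.
under eq_bigr do rewrite excesszE mulr_sumr.
rewrite exchange_big /=; apply: eq_bigr => e _.
have pick u : \sum_v pi v * (u == v)%:R = pi u.
  rewrite (bigD1 u) //= eqxx mulr1 big1 ?addr0 // => v.
  by rewrite eq_sym => /negPf ->; rewrite mulr0.
under eq_bigr => v _ do rewrite mulrCA mulrBr.
by rewrite -mulr_sumr sumrB !pick mulrC.
Qed.

(* The auxiliary arc (e, true) raises the flow on e by one unit, (e, false)
   lowers it. *)
Let aux := (A * bool)%type.
Let ahead (a : aux) := if a.2 then head a.1 else tail a.1.
Let atail (a : aux) := if a.2 then tail a.1 else head a.1.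
Let step (b : bool) : int := if b then 1 else -1.

Variable C : A -> int -> int.
Hypothesis C_convex : forall e t, C e t + C e t <= C e (t + 1) + C e (t - 1).
Hypothesis p_super : supermodular p.

Variable z : A -> int.
Hypothesis z_feas : feasible z.
Hypothesis z_opt : forall y, feasible y -> \sum_e C e (z e) <= \sum_e C e (y e).

Let residual (a : aux) := (f a.1 <= (z a.1 + step a.2)%:E <= g a.1)%E.
Let acost (a : aux) := C a.1 (z a.1 + step a.2) - C a.1 (z a.1).
(** Auxiliary arcs are the nodes here: a raises the excess at [ahead a], b lowers it at [atail b],
    and together this must be an exchange at psi_z. *)
Let r (a b : aux) :=
  [&& residual a, residual b & exchangeable p (excessz z) (ahead a) (atail b)].

Lemma aux_cycle_ge0 s : cycle r s -> 0 <= \sum_(a <- s) acost a.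
Proof.
move=> cs0; rewrite leNgt; apply/negP => neg0.
have [{cs0 neg0}s [l [[us neg] cs [l1 l2] al pl]]] := shortest_negative_cycle cs0 neg0.
have res1 q : q \in l -> residual q.1 /\ residual q.2.
  by move=> /(allP al)/and3P[].
have res a : a \in s -> residual a.
  by rewrite -(perm_mem l1) => /mapP[q /res1[rq _] ->].
pose ind a : int := (a \in s)%:R.
pose y e := z e + ind (e, true) - ind (e, false).
have sum_s (F : aux -> int) : \sum_(a <- s) F a = \sum_e (ind (e, true) * F (e, true)
    + ind (e, false) * F (e, false)).
  rewrite big_uniq // big_mkcond /=.
  rewrite (eq_bigr (fun a => ind (a.1, a.2) * F (a.1, a.2))); last first.
    by move=> [e b] _; rewrite /ind /=; case: ifP; rewrite ?mul1r ?mul0r.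
  rewrite -(pair_bigA _ (fun e b => ind (e, b) * F (e, b))) /=.
  by apply: eq_bigr => e _; rewrite big_bool.
have yf e : (f e <= (y e)%:E <= g e)%E.
  have /andP[fz zg] := z_feas.1 e.
  rewrite /y /ind; move: (res (e, true)) (res (e, false)); rewrite /residual /step /=.
  case: (_ \in s) => [/(_ isT) rt|_]; case: (_ \in s) => [/(_ isT) rf|_] /=.
  - by rewrite addrK fz zg.
  - by rewrite subr0.
  - by rewrite addr0.
  - by rewrite addr0 subr0 fz zg.
have yB : in_base p (excessz y).
  have := @exchange_seq_in_base _ _ p_super
    [seq (ahead q.1, atail q.2) | q <- l] _ z_feas.2.
  (* Both components of l run over s, so the exchanges add up to the change of excess from z to
     y. *)
  have -> : (fun v => excessz z v + \sum_(q <- [seq (ahead q.1, atail q.2) | q <- l])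
      ((q.1 == v)%:R - (q.2 == v)%:R)) = excessz y.
    apply/funext => v; rewrite big_map /= sumrB.
    rewrite -(big_map fst xpredT (fun a => (ahead a == v)%:R)).
    rewrite -(big_map snd xpredT (fun a => (atail a == v)%:R)).
    rewrite (perm_big _ l1) (perm_big _ l2) /= !sum_s !excesszE -sumrB -big_split /=.
    by apply: eq_bigr => e _; rewrite /y /ahead /atail /=; ring.
  apply; rewrite ?all_map ?pairwise_map.
    by apply/allP => q /(allP al)/and3P[].
  apply: (@sub_in_pairwise _ (mem l)) pl; last exact/allP.
  by move=> q q' /res1[rq _] /res1[_ rq']; rewrite /r /= rq rq'.
have := z_opt (conj yf yB).
(* Edgewise this is an equality, except that an edge used both ways contributes a second difference,
   nonnegative by convexity. *)
suff : \sum_e C e (y e) <= \sum_e C e (z e) + \sum_(a <- s) acost a by lia.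
rewrite sum_s -big_split /=; apply: ler_sum => e _.
rewrite /y /ind /acost /step /=.
case: (_ \in s); case: (_ \in s) => /=; rewrite ?mul1r ?mul0r ?addr0 ?subr0 ?addrK.
- by rewrite lerDl addrACA -opprD subr_ge0.
- by rewrite addrC subrK.
- by rewrite add0r addrC subrK.
- by [].
Qed.

Lemma optimal_potential : exists pi : V -> int,
  (forall s t, exchangeable p (excessz z) s t -> pi t <= pi s) /\
  forall e, ((f e <= (z e + 1)%:E <= g e)%E ->
      pi (head e) - pi (tail e) <= C e (z e + 1) - C e (z e)) /\
    ((f e <= (z e - 1)%:E <= g e)%E ->
      C e (z e) - C e (z e - 1) <= pi (head e) - pi (tail e)).
Proof.
have [d [dc dr]] := digraph_distance aux_cycle_ge0.
pose P v a := residual a && exchangeable p (excessz z) (ahead a) v.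
(* Distances live on auxiliary arcs; pi v is the least one over arcs that can pass on to v. The
   default 0 stands for the empty walk and agrees with [d a <= acost a]. *)
pose pi v := \big[Num.min/0]_(a | P v a) d a.
have pi_le v a : P v a -> pi v <= d a by move=> Pa; apply: bigmin_le_cond.
have pi0 v : pi v <= 0 by apply: bigmin_le_id.
have res_le a : residual a -> pi (ahead a) <= pi (atail a) + acost a.
  move=> ra; apply: (@le_trans _ _ (d a)).
    by apply: pi_le; rewrite /P ra exchangeable_refl.
  rewrite -lerBlDr; apply/bigmin_geP; split=> [|b /andP[rb eb]].
    by rewrite lerBlDr add0r dc.
  by rewrite lerBlDr dr // /r rb ra.
exists pi; split=> [s t st|e].
  apply/bigmin_geP; split=> [|a /andP[ra ea]]; first exact: pi0.
  by apply: pi_le; rewrite /P ra (exchangeable_trans ea st).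
split=> ra.
  by have := res_le (e, true) ra; rewrite lerBlDl.
by have := res_le (e, false) ra; rewrite -lerBlDl -opprB lerNl opprB.
Qed.

End SubmodularFlow.

(** * Minimizers of the saturation cost tilted by a linear term *)

Section SaturationCost.
Variables (A : finType) (g : A -> \bar int) (L : {set A}).

(* A convex extension to all of int of the indicator of [t = g e] on
   [t <= g e], for e in L. *)
Definition saturation_cost (e : A) (t : int) : int :=
  if (e \in L, g e) is (true, G%:E) then Num.max 0 (t - G + 1) else 0.

Lemma saturation_cost_convex e t :
  saturation_cost e t + saturation_cost e t <=
  saturation_cost e (t + 1) + saturation_cost e (t - 1).
Proof. by rewrite /saturation_cost; case: (e \in L); case: (g e) => [G||] //; lia. Qed.

Lemma card_saturated (z : A -> int) : (forall e, (z e)%:E <= g e)%E ->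
  #|saturated g L z|%:Z = \sum_e saturation_cost e (z e).
Proof.
move=> zg; rewrite -natz -sumr_const big_mkcond; apply: eq_bigr => e _.
rewrite /saturated inE /saturation_cost; move: (zg e).
case: (e \in L) => //=; case: (g e) => [G||] //=; rewrite lee_fin eqe.
by case: eqP; lia.
Qed.

(** For e in L with g e = G finite, the slope is 0 up to G - 1 and 1 on the last step to G;
    otherwise it is 0 throughout. Only D equal to such a slope allows minimizers other than z. *)
Lemma saturation_cost_argmin (f : A -> \bar int) e (z D : int) :
  (f e <= z%:E <= g e)%E -> f e != +oo%E -> g e != -oo%E ->
  ((f e <= (z + 1)%:E <= g e)%E ->
      D <= saturation_cost e (z + 1) - saturation_cost e z) ->
  ((f e <= (z - 1)%:E <= g e)%E ->
      saturation_cost e z - saturation_cost e (z - 1) <= D) ->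
  let w t := saturation_cost e t - D * t in
  exists ab : \bar int * \bar int,
    [/\ ab.1 != +oo%E /\ ab.2 != -oo%E,
        [/\ f e <= ab.1, ab.1 <= ab.2 & ab.2 <= g e]%E,
        forall t, (f e <= t%:E <= g e)%E -> w z <= w t
      & forall t, (ab.1 <= t%:E <= ab.2)%E <->
          (f e <= t%:E <= g e)%E /\ w t = w z].
Proof.
move=> /andP[fz zg] f_fin g_fin up down w.
have {}up t : (f e <= t%:E <= g e)%E -> z < t ->
    D <= saturation_cost e (z + 1) - saturation_cost e z.
  move=> /andP[ft tg] zt; apply: up; rewrite (le_trans fz) /= ?lee_fin ?lerDl //.
  by apply: le_trans tg; rewrite lee_fin lezD1.
have {}down t : (f e <= t%:E <= g e)%E -> t < z ->
    saturation_cost e z - saturation_cost e (z - 1) <= D.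
  move=> /andP[ft tg] tz; apply: down; apply/andP; split.
    by apply: (le_trans ft); rewrite lee_fin; lia.
  by apply: le_trans zg; rewrite lee_fin; lia.
have single : (forall t, (f e <= t%:E <= g e)%E -> t != z -> w z < w t) ->
    exists ab : \bar int * \bar int,
    [/\ ab.1 != +oo%E /\ ab.2 != -oo%E,
        [/\ f e <= ab.1, ab.1 <= ab.2 & ab.2 <= g e]%E,
        forall t, (f e <= t%:E <= g e)%E -> w z <= w t
      & forall t, (ab.1 <= t%:E <= ab.2)%E <->
          (f e <= t%:E <= g e)%E /\ w t = w z].
  move=> wz; exists (z%:E, z%:E); split=> //.
    by move=> t ft; have [->//|tz] := eqVneq t z; rewrite ltW ?wz.
  move=> t /=; rewrite !lee_fin -eq_le; split=> [/eqP <-|[ft wt]]; first by rewrite fz zg.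
  by rewrite eq_sym; apply: contraPT wt => tz; have := wz _ ft tz; lia.
have [c0|[G [gG cE]]] : (saturation_cost e = fun=> 0) \/
    exists G, g e = G%:E /\ saturation_cost e = fun t => Num.max 0 (t - G + 1).
  rewrite /saturation_cost; case: (e \in L); last by left.
  by case: (g e) => [G||]; [right; exists G | left | left].
  rewrite {}/w in single *; rewrite c0 in up down single *.
  have [D0|D0] := eqVneq D 0.
    rewrite D0; exists (f e, g e); split=> //.
    - by split=> //; apply: le_trans zg.
    - by move=> t _; lia.
    - by move=> t; split=> [ft|[]//]; split=> //; lia.
  apply: single => t ft; rewrite neq_lt !sub0r ltrN2 => /orP[tz|zt].
    by have := down _ ft tz; nia.
  by have := up _ ft zt; nia.
rewrite {}/w in single *; rewrite cE gG in up down single zg *.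
(* If f e = G the value is forced; otherwise G - 1 and G are both feasible and test the optimality
   of z. *)
have [fG|nfG] := eqVneq (f e) G%:E.
  apply: single => t; rewrite fG -eq_le => /eqP[<-].
  by move: fz zg; rewrite fG !lee_fin; lia.
have fG : (f e <= (G - 1)%:E)%E.
  move: nfG (le_trans fz zg); case: (f e) f_fin => [F||] // _; last by rewrite !leNye.
  by rewrite eqe !lee_fin; lia.
have fG' : (f e <= G%:E <= G%:E)%E.
  by rewrite lexx andbT (le_trans fG) // lee_fin; lia.
have fG1 : (f e <= (G - 1)%:E <= G%:E)%E by rewrite fG lee_fin; lia.
rewrite lee_fin in zg.
have [D0|D0] := eqVneq D 0.
  have zG : z <= G - 1 by have := down _ fG1; lia.
  rewrite D0; exists (f e, (G - 1)%:E); split=> //.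
  - by split=> //; rewrite lee_fin; lia.
  - by move=> t _; lia.
  - by move=> t /=; case: (f e <= t%:E)%E; rewrite ?lee_fin /=; lia.
have [D1|D1] := eqVneq D 1.
  have zG : G - 1 <= z by have := up _ fG'; lia.
  rewrite D1; exists ((G - 1)%:E, G%:E); split=> //.
  - by split=> //; rewrite lee_fin; lia.
  - by move=> t /andP[_]; rewrite lee_fin; lia.
  - move=> t /=; rewrite !lee_fin; split=> [tG|[/andP[_]]]; last by lia.
    split; last by lia.
    by rewrite (le_trans fG) ?lee_fin; lia.
apply: single => t ft; rewrite neq_lt => /orP[tz|zt].
  have := down _ ft tz; nia.
have := up _ ft zt; nia.
Qed.

End SaturationCost.

(** * Integral points of the real polyhedra *)

Section RealTransfer.
Variables (R : realType) (V A : finType) (tail head : A -> V).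

Lemma exint_le_int (a : \bar int) (t : int) :
  (exint R a <= (t%:~R)%:E)%E = (a <= t%:E)%E.
Proof. by case: a => [a||] //=; rewrite ?lee_fin ?ler_int ?leNye. Qed.

Lemma int_le_exint (a : \bar int) (t : int) :
  ((t%:~R)%:E <= exint R a)%E = (t%:E <= a)%E.
Proof. by case: a => [a||] //=; rewrite ?lee_fin ?ler_int ?leey. Qed.

Lemma excess_intvec (z : A -> int) :
  excess tail head (intvec R z) = intvec R (excessz tail head z).
Proof. by apply/funext => v; rewrite /excess /intvec /excessz rmorphB /= !rmorph_sum. Qed.

Lemma wt_intvec (x : V -> int) (Z : {set V}) : wt (intvec R x) Z = (wtz x Z)%:~R.
Proof. by rewrite /wt /wtz /intvec rmorph_sum. Qed.

Lemma base_poly_intvec (p : {set V} -> \bar int) (x : V -> int) :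
  base_poly p (intvec R x) <-> in_base p x.
Proof.
rewrite /base_poly /in_base /=.
have -> : ((wt (intvec R x) [set: V]%SET)%:E = exint R (p [set: V]%SET)) <->
          ((wtz x [set: V]%SET)%:E = p [set: V]%SET).
  rewrite wt_intvec; case: (p _) => [a||] //=.
  by split=> [[/eqP]|[->]//]; rewrite eqr_int => /eqP ->.
by split=> -[-> h]; split=> // Z; have := h Z; rewrite wt_intvec exint_le_int.
Qed.

Lemma base_flow_intvec (f g : A -> \bar int) (B : set (V -> R)) (z : A -> int) :
  base_flow tail head f g B (intvec R z) <->
  (forall e, (f e <= (z e)%:E <= g e)%E) /\ B (intvec R (excessz tail head z)).
Proof.
rewrite /base_flow /= excess_intvec; split=> -[zfg zB]; split=> // e.
  by have := zfg e; rewrite exint_le_int int_le_exint.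
by rewrite exint_le_int int_le_exint.
Qed.

Lemma face_refl (B : set (V -> R)) : B !=set0 -> face B B.
Proof.
move=> B0; split=> //; exists (fun=> 0), 0; split=> [x _|].
  by rewrite big1 // => v _; rewrite mul0r.
by apply/seteqP; split=> x /= => [|[]//]; split=> //; rewrite big1 // => v _; rewrite mul0r.
Qed.

(* Abel summation over the superlevel sets of pi, all of which are tight. *)
Lemma base_poly_potential_min (p : {set V} -> \bar int) (x pi : V -> int) (y : V -> R) :
  supermodular p -> in_base p x ->
  (forall s t, exchangeable p x s t -> pi t <= pi s) -> base_poly p y ->
  \sum_v (pi v)%:~R * (x v)%:~R <= \sum_v (pi v)%:~R * y v.
Proof.
move=> p_super xB pi_ex [yV yp].
rewrite -subr_ge0 -sumrB; under eq_bigr do rewrite -mulrBr.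
have px Z : p Z = (wtz x Z)%:E -> 0 <= \sum_(v in Z) (y v - (x v)%:~R).
  move=> pZ; have := yp Z; rewrite pZ /= lee_fin => h.
  by rewrite sumrB subr_ge0 -(rmorph_sum intr).
apply: sum_superlevel_ge0 => [|k].
  have sumT (u : V -> R) : \sum_v u v = wt u [set: V]%SET.
    by apply: eq_bigl => v; rewrite inE.
  move: yV; rewrite -xB.1 => -[yV].
  by rewrite sumrB !sumT yV (wt_intvec x) subrr.
have /eqP/px := potential_superlevel_tight p_super xB pi_ex k.
by under eq_bigl do rewrite inE.
Qed.

End RealTransfer.

Theorem theorem2p1 (R : realType) (V A : finType) (tail head : A -> V)
    (loopless : forall e, tail e != head e)
    (f g : A -> \bar int)
    (f_fin : forall e, f e != +oo%E) (g_fin : forall e, g e != -oo%E)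
    (le_fg : forall e, (f e <= g e)%E)
    (B : set (V -> R)) (B_base : integral_base_polyhedron B)
    (Q_neq0 : base_flow tail head f g B !=set0)
    (L : {set A})
    (L_fin : forall e, e \in L -> (f e \is a fin_num) && (g e \is a fin_num)) :
  exists (B_L : set (V -> R)) (f_L g_L : A -> \bar int),
    [/\ face B B_L,
        (forall e, f_L e != +oo%E) /\ (forall e, g_L e != -oo%E),
        forall e, [/\ (f e <= f_L e)%E, (f_L e <= g_L e)%E & (g_L e <= g e)%E]
      & forall z : A -> int,
          upper_minimizer (base_flow tail head f g B) g L z <->
          base_flow tail head f_L g_L B_L (intvec R z)].
Proof.
have [p [p_super pV BE]] := B_base; subst B.
have flowP y : base_flow tail head f g (base_poly p) (intvec R y) <->
    feasible tail head f g p y.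
  by rewrite base_flow_intvec base_poly_intvec.
have B_neq0 : base_poly (R:=R) p !=set0.
  by have [x [_ xB]] := Q_neq0; exists (excess tail head x).
(* Without an integral point no z satisfies either side, and B, f, g serve. *)
have [[y0 y0_feas]|no_int] := pselect (exists y, feasible tail head f g p y); last first.
  exists (base_poly p), f, g; split=> //; first exact: face_refl.
  move=> z; split=> [[/flowP zf _]|/flowP zf]; by case: no_int; exists z.
pose P n := `[< exists y, feasible tail head f g p y /\ #|saturated g L y| = n >].
have exP : exists n, P n by exists #|saturated g L y0|; apply/asboolP; exists y0.
case: (ex_minnP exP) => m /asboolP[z [z_feas zm]] min_m.
have {}min_m y : feasible tail head f g p y -> (m <= #|saturated g L y|)%N.
  by move=> yf; apply: min_m; apply/asboolP; exists y.
pose C := saturation_cost g L.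
have card_cost y : feasible tail head f g p y ->
    #|saturated g L y|%:Z = \sum_e C e (y e).
  by move=> [yfg _]; apply: card_saturated => e; have /andP[] := yfg e.
have z_opt y : feasible tail head f g p y -> \sum_e C e (z e) <= \sum_e C e (y e).
  by move=> yf; rewrite -!card_cost // zm lez_nat min_m.
have [pi [pi_ex pi_edge]] := optimal_potential (saturation_cost_convex g L) p_super z_feas z_opt.
pose D e := pi (head e) - pi (tail e).
pose w e t := C e t - D e * t.
have edge e := saturation_cost_argmin (z_feas.1 e) (f_fin e) (g_fin e)
  (pi_edge e).1 (pi_edge e).2.
have [ab abP] := choice edge.
(* The potential is the normal of the face, and d is its minimum over the base polyhedron, attained
   at psi_z. *)
pose c v : R := (pi v)%:~R.
pose d : R := \sum_v c v * (excessz tail head z v)%:~R.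
have pot_min y : base_poly p y -> d <= \sum_v c v * y v.
  exact: base_poly_potential_min z_feas.2 pi_ex.
have costE y : \sum_e C e (y e) =
    \sum_e w e (y e) + \sum_v pi v * excessz tail head y v.
  by rewrite sum_potential_excess -big_split; apply: eq_bigr => e _ /=; rewrite subrK.
have dotE y : \sum_v c v * intvec R (excessz tail head y) v =
    (\sum_v pi v * excessz tail head y v)%:~R.
  by rewrite rmorph_sum; apply: eq_bigr => v _; rewrite rmorphM.
exists [set x | base_poly p x /\ \sum_v c v * x v = d],
  (fun e => (ab e).1), (fun e => (ab e).2); split.
- split; last by exists c, d.
  exists (intvec R (excessz tail head z)); split=> //.
  by apply/base_poly_intvec; have [] := z_feas.
- by split=> e; have [[]] := abP e.
- by move=> e; have [_ []] := abP e.
move=> y; rewrite base_flow_intvec /=.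
have dz : d = (\sum_v pi v * excessz tail head z v)%:~R by rewrite -dotE.
split=> [[/flowP yf y_min]|[yab [yB yd]]].
  (* Equal total costs, with neither part of the split smaller at y than at z, force both parts to
     agree, the first one edge by edge. *)
  have ym : \sum_e C e (y e) = \sum_e C e (z e).
    apply/eqP; rewrite eq_le z_opt // andbT -!card_cost // lez_nat.
    by apply: y_min; apply/flowP.
  have wge e : w e (z e) <= w e (y e).
    by have [_ _ h _] := abP e; apply: h; apply: yf.1.
  have yB : base_poly p (intvec R (excessz tail head y)).
    by apply/base_poly_intvec; have [] := yf.
  have pge : \sum_v pi v * excessz tail head z v <= \sum_v pi v * excessz tail head y v.
    by rewrite -(ler_int R) -dz -dotE pot_min.
  have sge : \sum_e w e (z e) <= \sum_e w e (y e) by apply: ler_sum.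
  rewrite !costE in ym.
  have ws : \sum_e w e (z e) = \sum_e w e (y e) by lia.
  split; last by split=> //; rewrite dotE dz; congr (_%:~R); lia.
  move=> e; have [_ _ _ ->] := abP e; split; first exact: yf.1.
  have : \sum_e (w e (y e) - w e (z e)) = 0 by rewrite sumrB ws subrr.
  move/eqP; rewrite psumr_eq0; last by move=> i _; rewrite subr_ge0.
  by move=> /allP /(_ e (mem_index_enum e))/implyP/(_ isT); rewrite subr_eq0 => /eqP.
have yf : feasible tail head f g p y.
  split; last by move/base_poly_intvec: yB.
  by move=> e; have [_ _ _ h] := abP e; have [] := (h (y e)).1 (yab e).
split; first exact/flowP.
move=> y' /flowP y'f.
suff -> : #|saturated g L y| = #|saturated g L z| by rewrite zm min_m.
(* Both parts of the split take the same value at y and z, hence so do the costs. *)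
apply/eqP; rewrite -eqz_nat !card_cost // !costE.
rewrite (eq_bigr (fun e => w e (z e))); last first.
  by move=> e _; have [_ _ _ h] := abP e; have [] := (h (y e)).1 (yab e).
apply/eqP; congr (_ + _).
by apply/eqP; rewrite -(eqr_int R) -dz -dotE yd.
Qed.
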